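(* For any hereditary graph property $\mathcal{P}$, as $n\to\infty$, \[ \mathrm{min\text{-}cost}_n(\mathcal{P}) = \Omega\!\left(\frac{\log n}{\log\log n}\right). \]
   Context: Node-query setting: a graph $G=(V,E)$ on $n$ vertices and a graph property $\mathcal{P}$ are fixed. An unknown subset $S \subseteq V$ is accessible only via queries ''Does $i \in S$?''. $\mathrm{cost}(\mathcal{P},G)$ is the deterministic query complexity (worst-case number of queries of an optimal decision tree) of deciding whether the induced subgraph $G[S]$ satisfies $\mathcal{P}$. A vertex $i$ of $G$ is relevant for $\mathcal{P}$ if there is some $S \ni i$ such that exactly one of $G[S]$ and $G[S\setminus\{i\}]$ satisfies $\mathcal{P}$; $G$ is relevant for $\mathcal{P}$ if all its vertices are relevant. $\mathrm{min\text{-}cost}_n(\mathcal{P}) = \min\{\mathrm{cost}(\mathcal{P},G) : G \text{ relevant for } \mathcal{P},\ |V(G)|=n\}$. A property is hereditary if it is closed under deletion of vertices and of edges. *)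

(* Defs.v *)
From HB Require Import structures.
From mathcomp Require Import all_boot all_order all_algebra.
From mathcomp Require Import all_classical all_reals all_analysis.
Set Implicit Arguments.
Unset Strict Implicit.
Unset Printing Implicit Defensive.
Import Order.TTheory GRing.Theory Num.Theory.
Import numFieldNormedType.Exports.

(* Graphs without vertices are allowed: G[S] with S empty must be a graph. *)
Record sgraph : Type := SGraph {
  vertex :> finType;
  edge : rel vertex;
  edge_sym : symmetric edge;
  edge_irrefl : irreflexive edge
}.

Definition graph_iso (G H : sgraph) : Prop :=
  exists f : G -> H,
    bijective f /\ forall x y : G, edge (f x) (f y) = edge x y.

Definition graph_property (P : sgraph -> Prop) : Prop :=
  forall G H : sgraph, graph_iso G H -> P G -> P H.

Section Subgraphs.
Variable G : sgraph.

Definition induced_edge (S : {set G}) : rel {x : G | x \in S} :=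
  fun x y => edge (val x) (val y).

Lemma induced_edge_sym (S : {set G}) : symmetric (@induced_edge S).
Proof. by move=> x y; exact: edge_sym. Qed.

Lemma induced_edge_irrefl (S : {set G}) : irreflexive (@induced_edge S).
Proof. by move=> x; exact: edge_irrefl. Qed.

Definition induced (S : {set G}) : sgraph :=
  SGraph (@induced_edge_sym S) (@induced_edge_irrefl S).

Definition del_vertex (v : G) : sgraph := induced (~: [set v])%SET.

Definition del_edge_rel (u v : G) : rel G :=
  fun x y => edge x y && ([set x; y]%SET != [set u; v]%SET).

Lemma del_edge_sym (u v : G) : symmetric (del_edge_rel u v).
Proof. by move=> x y; rewrite /del_edge_rel edge_sym finset.setUC. Qed.

Lemma del_edge_irrefl (u v : G) : irreflexive (del_edge_rel u v).
Proof. by move=> x; rewrite /del_edge_rel edge_irrefl. Qed.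

Definition del_edge (u v : G) : sgraph :=
  SGraph (del_edge_sym u v) (del_edge_irrefl u v).

End Subgraphs.

Definition hereditary (P : sgraph -> Prop) : Prop :=
  (forall (G : sgraph) (v : G), P G -> P (del_vertex v)) /\
  (forall (G : sgraph) (u v : G), edge u v -> P G -> P (del_edge u v)).

Definition node_fun (P : sgraph -> Prop) (G : sgraph) : {set G} -> bool :=
  fun S => `[< P (induced S) >].

Definition relevant_vertex (P : sgraph -> Prop) (G : sgraph) (i : G) : Prop :=
  exists S : {set G}, i \in S /\ node_fun P S != node_fun P (S :\ i)%SET.

Definition relevant (P : sgraph -> Prop) (G : sgraph) : Prop :=
  forall i : G, relevant_vertex P i.

(* [Query i yes no] asks whether i belongs to S. *)
Inductive dtree (V : Type) : Type :=
| Answer (b : bool)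
| Query (i : V) (yes no : dtree V).
Arguments Answer {V} b.

Section DecisionTrees.
Variable V : finType.

Fixpoint run (t : dtree V) (S : {set V}) : bool :=
  match t with
  | Answer b => b
  | Query i yes no => if i \in S then run yes S else run no S
  end.

Fixpoint queries (t : dtree V) (S : {set V}) : nat :=
  match t with
  | Answer _ => 0
  | Query i yes no => (if i \in S then queries yes S else queries no S).+1
  end.

Definition worst_case (t : dtree V) : nat := \max_(S : {set V}) queries t S.

Definition computes (t : dtree V) (f : {set V} -> bool) : Prop :=
  forall S : {set V}, run t S = f S.

Definition achievable (f : {set V} -> bool) : pred nat :=
  fun d => `[< exists t : dtree V, computes t f /\ worst_case t = d >].

Lemma computesP (f : {set V} -> bool) : exists t : dtree V, computes t f.
Proof.
suff [t Ht] : exists t, forall S : {set V},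
    run t S = f (S :&: [set:: enum V])%SET.
  exists t => S; rewrite Ht; congr f.
  by apply/setP => x; rewrite !inE mem_enum andbT.
elim: (enum V) f => [|i s IH] f.
  by exists (Answer (f finset.set0)) => S /=; congr f; apply/setP => x; rewrite !inE andbF.
have [yes Hyes] := IH (fun A => f (i |: A)%SET).
have [no Hno] := IH (fun A => f (A :\ i)%SET).
exists (Query i yes no) => S /=; case: ifPn => iS.
  rewrite Hyes; congr f; apply/setP => x; rewrite !inE.
  by case: (eqVneq x i) => [->|]; rewrite ?iS.
rewrite Hno; congr f; apply/setP => x; rewrite !inE.
by case: (eqVneq x i) => [->|]; rewrite ?(negbTE iS).
Qed.

Lemma achievableP (f : {set V} -> bool) : exists d, achievable f d.
Proof.
by have [t Ht] := computesP f; exists (worst_case t); apply/asboolP; exists t.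
Qed.

Definition query_complexity (f : {set V} -> bool) : nat :=
  ex_minn (achievableP f).

End DecisionTrees.

Definition cost (P : sgraph -> Prop) (G : sgraph) : nat :=
  query_complexity (node_fun P (G := G)).

(* The values are natural numbers, so the infimum is a minimum as soon as a
   relevant graph on n vertices exists; otherwise it is +oo. *)
Definition min_cost (R : realType) (P : sgraph -> Prop) (n : nat) : \bar R :=
  ereal_inf [set x : \bar R | exists G : sgraph,
    [/\ relevant P G, #|G| = n & x = ((cost P G)%:R)%:E]]%classic.

(* Main.v *)
(** Switching the membership of a relevant vertex [i] in a suitable [S] changes
    the answer, so every correct decision tree asks about [i] on some computation
    path. The paths of a tree of depth [d] contain at most [2 ^ d - 1] query
    nodes, hence [n < 2 ^ d] as soon as all [n] vertices are relevant. This gives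
    [ln n <= cost], which is stronger than the required bound. *)
Require Import Defs.
From mathcomp Require Import all_boot all_order all_algebra.
From mathcomp Require Import all_classical all_reals all_analysis.
Import Order.TTheory GRing.Theory Num.Theory.
Import numFieldNormedType.Exports.
Local Open Scope classical_set_scope.
Local Open Scope ring_scope.

Section QueriedElements.
Variable V : finType.
Implicit Types (t : dtree V) (S : {set V}) (A : {set {set V}}).

Fixpoint path_queries t S : {set V} :=
  match t with
  | Answer _ => finset.set0
  | Query i yes no =>
      (i |: (if i \in S then path_queries yes S else path_queries no S))%SET
  end.

(** If the path of [S] never asks about [i], both inputs give the same answers along it and reach
    the same leaf. *)
Lemma run_setD1 t S i :
  i \notin path_queries t S -> run t (S :\ i)%SET = run t S.
Proof.
elim: t => [//|j yes IHyes no IHno] /=.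
rewrite in_setU1 negb_or in_setD1 eq_sym => /andP[-> /=].
by case: ifP => _; [exact: IHyes|exact: IHno].
Qed.

(* Restricting to the inputs in [A] discards the nodes that become unreachable
   when a tree asks the same question twice on a path; these are not bounded by
   [worst_case]. *)
Lemma card_path_queries t A d :
  (forall S, S \in A -> (queries t S <= d)%N) ->
  (#|(\bigcup_(S in A) path_queries t S)%SET| < 2 ^ d)%N.
Proof.
elim: t A d => [b|i yes IHyes no IHno] A d le_d.
  by rewrite big1 ?cards0 ?expn_gt0.
have [->|[S0 S0A]] := set_0Vmem A; first by rewrite big_set0 cards0 expn_gt0.
(* The root query already costs one on [S0], so [d] is positive and one query less is left for each
   subtree. *)
case: d le_d => [/(_ _ S0A) //|d le_d].
pose A1 := [set S in A | i \in S]%SET; pose A0 := [set S in A | i \notin S]%SET.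
pose C1 := (\bigcup_(S in A1) path_queries yes S)%SET.
pose C0 := (\bigcup_(S in A0) path_queries no S)%SET.
have lt1 : (#|C1| < 2 ^ d)%N.
  apply: IHyes => S; rewrite inE => /andP[SA iS].
  by have := le_d S SA; rewrite /= iS ltnS.
have lt0 : (#|C0| < 2 ^ d)%N.
  apply: IHno => S; rewrite inE => /andP[SA /negbTE iS].
  by have := le_d S SA; rewrite /= iS ltnS.
have sub : (\bigcup_(S in A) path_queries (Query i yes no) S)%SET
    \subset (i |: (C1 :|: C0))%SET.
  apply/finset.bigcupsP => S SA /=; apply: finset.setUS; case: ifPn => iS.
    apply: fintype.subset_trans (finset.subsetUl _ _).
    have SA1 : S \in A1 by rewrite inE SA iS.
    exact: (finset.bigcup_sup S SA1).
  apply: fintype.subset_trans (finset.subsetUr _ _).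
  have SA0 : S \in A0 by rewrite inE SA iS.
  exact: (finset.bigcup_sup S SA0).
apply: leq_ltn_trans (subset_leq_card sub) _.
rewrite cardsU1 expnS mul2n -addnn.
(* The two strict bounds leave a slack of two: one unit pays for the root [i], the other keeps the
   result strict. *)
apply: leq_trans (leq_add lt1 lt0); rewrite addSn addnS ltnS.
by rewrite -add1n leq_add ?leq_b1 // leq_card_setU.
Qed.

Lemma card_lt_expn_worst_case t (f : {set V} -> bool) :
  computes t f -> (forall i, exists S, f S != f (S :\ i)%SET) ->
  (#|V| < 2 ^ worst_case t)%N.
Proof.
move=> tf sens; have: forall S, S \in [set: {set V}]%SET ->
    (queries t S <= worst_case t)%N by move=> S _; exact: leq_bigmax.
move/card_path_queries; apply: leq_ltn_trans; rewrite -cardsT subset_leq_card //.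
apply/fintype.subsetP => i _; have [S fS] := sens i.
apply/finset.bigcupP; exists S; rewrite ?finset.in_setT //.
by apply: contraNT fS => /run_setD1; rewrite !tf => ->.
Qed.

End QueriedElements.

Lemma card_lt_expn_cost (P : sgraph -> Prop) (G : sgraph) :
  relevant P G -> (#|G| < 2 ^ cost P G)%N.
Proof.
move=> relG; rewrite /cost /query_complexity.
case: ex_minnP => d /asboolP[t [tP <-]] _.
by apply: card_lt_expn_worst_case tP _ => i; have [S []] := relG i; exists S.
Qed.

Lemma ln_le_of_lt_expn2 (R : realType) (n d : nat) :
  (n < 2 ^ d)%N -> ln (n%:R : R) <= d%:R.
Proof.
(* By convention [ln] is 0 at 0. *)
case: n => [|n] n_lt; first by rewrite ln0.
(* It remains to see that n <= 2^d <= e^d, where 2 = 1 + 1 <= e. *)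
rewrite -[leRHS]expRK ler_ln ?posrE ?expR_gt0 ?ltr0n //.
apply: le_trans (_ : (2 ^ d)%:R <= _); first by rewrite ler_nat ltnW.
rewrite natrX -[d%:R]mulr_natl mulr1 -[d%:R]mulr1 expRM_natl lerXn2r ?nnegrE //.
exact: expR_ge1Dx.
Qed.

Theorem theorem3 (R : realType) (P : sgraph -> Prop)
    (propP : graph_property P) (hered : hereditary P) :
  exists c : R, 0 < c /\
    \forall n \near \oo,
      ((c * (ln n%:R / ln (ln n%:R)))%:E <= min_cost R P n)%E.
Proof.
exists 1; split=> //; near=> n.
(* From e^e on, [ln (ln n%:R)] is at least 1, so dividing [ln n%:R] by it does not increase it. *)
have n_ge : expR (expR 1) <= n%:R :> R by near: n; exact: nbhs_infty_ger.
have ln_ge : expR 1 <= ln (n%:R : R).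
  by rewrite -[leLHS]expRK ler_ln ?posrE ?expR_gt0 //
    (lt_le_trans _ n_ge) ?expR_gt0.
have lnln_ge : 1 <= ln (ln (n%:R : R)).
  by rewrite -[leLHS]expRK ler_ln ?posrE ?expR_gt0 //
    (lt_le_trans _ ln_ge) ?expR_gt0.
apply: le_ereal_inf_tmp => _ [G [relG Gn ->]]; rewrite lee_fin mul1r.
apply: (@le_trans _ _ (ln n%:R)).
  rewrite ler_pdivrMr ?(lt_le_trans ltr01) // ler_peMr //.
  exact: le_trans (expR_ge0 _) ln_ge.
by apply: ln_le_of_lt_expn2; rewrite -Gn card_lt_expn_cost.
Unshelve. all: by end_near.
Qed.
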